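(* Let $n\ge0$ be an integer, $\beta$ a complex number, and $G_n^\beta=U_nE^{n\beta}U_n^{-1}$ acting on the space $\mathcal P_n$ of complex polynomials of degree at most $n$. Then $$G_n^{-\beta}=J_n\,G_n^\beta\,J_n ,$$ where $J_n$ is the operator $x^p\mapsto x^{n-p}$ on $\mathcal P_n$.
   Context: The Euler polynomials $A_k(x)$ are defined by $\frac{A_k(x)}{(1-x)^{k+1}}=\sum_{m\ge0}m^kx^m$, with $A_0=1$. $U_n$ is the linear operator on $\mathcal P_n$ with $U_n x^p=\frac1{n!}(1-x)^{n-p}A_p(x)$, $p=0,\dots,n$; it is invertible with $U_n^{-1}x^p=(x)_p[x+1]_{n-p}$ (falling and rising factorials). $E^{c}$ is the shift operator $f(x)\mapsto f(x+c)$. *)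

(* Defs.v *)
From HB Require Import structures.
From mathcomp Require Import all_boot all_order all_algebra.
From mathcomp Require Import qpoly ring.
From mathcomp Require Import reals complex.

Set Implicit Arguments.
Unset Strict Implicit.
Unset Printing Implicit Defensive.

Import Order.TTheory GRing.Theory Num.Theory.
Local Open Scope ring_scope.

Section EulerPolynomials.
Variable K : numFieldType.

(* A(x) / (1-x)^(k+1) = \sum_(m >= 0) m^k x^m as formal power series, cleared
   of its denominator: the coefficient of x^j in A is that of the Cauchy product
   (1-x)^(k+1) * \sum_m m^k x^m.  As usual 0^0 = 1, so that A = 1 for k = 0. *)
Definition is_euler_poly (k : nat) (A : {poly K}) : Prop :=
  forall j : nat,
    A`_j = \sum_(i < j.+1) ((1 - 'X) ^+ k.+1 : {poly K})`_i * (j - i)%:R ^+ k.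

Lemma is_euler_poly_uniq k A B : is_euler_poly k A -> is_euler_poly k B -> A = B.
Proof. by move=> hA hB; apply/polyP => j; rewrite hA hB. Qed.

Fixpoint euler_rec k : {poly K} :=
  if k is k'.+1 then
    (1 - 'X) * ('X * (euler_rec k')^`()) + k'.+1%:R *: ('X * euler_rec k')
  else 1.

Lemma size_euler_rec k : (size (euler_rec k) <= k.+1)%N.
Proof.
elim: k => [|k IH] /=; first by rewrite size_poly1.
have hX : (size ('X * (euler_rec k)^`())%R <= k.+1)%N.
  apply/leq_sizeP => -[|j] hj; rewrite coefXM //= coef_deriv.
  by rewrite nth_default ?mul0rn // (leq_trans IH).
rewrite (leq_trans (size_polyD _ _)) // geq_max; apply/andP; split.
  rewrite (leq_trans (size_polyMleq _ _)) //.
  have : (size (1 - 'X : {poly K})%R <= 2)%N.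
    by rewrite (leq_trans (size_polyD _ _)) // size_polyN size_polyX size_poly1.
  by case: (size (1 - 'X : {poly K})%R) => [|[|[|]]] //= _;
    rewrite ?add0n ?add1n ?add2n /= ?(leq_trans (leq_pred _)) ?(leq_trans hX).
rewrite (leq_trans (size_scale_leq _ _)) //.
by rewrite (leq_trans (size_polyMleq _ _)) // size_polyX.
Qed.

Lemma euler_rec1 k : (euler_rec k).[1] = k`!%:R.
Proof.
elim: k => [|k IH] /=; first by rewrite hornerE.
by rewrite !hornerE IH subrr /= !mul0r add0r mulr1 factS natrM.
Qed.

Lemma euler_rec_series k N : exists Q : {poly K},
  euler_rec k = (1 - 'X) ^+ k.+1 * \poly_(m < N) (m%:R ^+ k) + 'X^N * Q.
Proof.
elim: k => [|k [Q IH]].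
  exists 1; rewrite expr1 mulr1 /=; elim: N => [|N IHN].
    by rewrite poly_def big_ord0 mulr0 add0r.
  rewrite [LHS]IHN !poly_def big_ord_recr /= !expr0 !scale1r exprS.
  by rewrite mulrDr mulrBl; ring.
exists ((1 - 'X) * (N%:R *: Q + 'X * Q^`()) + k.+1%:R *: ('X * Q)).
have hS : \poly_(m < N) (m%:R ^+ k.+1)
        = 'X * (\poly_(m < N) (m%:R ^+ k))^`() :> {poly K}.
  apply/polyP => -[|j]; rewrite coefXM coef_poly /=; first by rewrite expr0n /= if_same.
  by rewrite coef_deriv coef_poly; case: ifP => _; rewrite ?mul0rn // exprSr mulr_natr.
have hXN : 'X * ('X^N)^`() = N%:R *: 'X^N :> {poly K}.
  case: N {IH hS} => [|N]; first by rewrite derivC mulr0 scale0r.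
  by rewrite derivXn exprS mulrnAr scaler_nat.
have hL : 'X * ((1 - 'X) ^+ k.+1)^`() = - (k.+1%:R *: ('X * (1 - 'X) ^+ k)) :> {poly K}.
  by rewrite deriv_exp derivB derivC derivX sub0r /= mulN1r mulNrn mulrN mulrnAr scaler_nat.
rewrite /=; have -> : 'X * (euler_rec k)^`() =
    - (k.+1%:R *: ('X * (1 - 'X) ^+ k)) * \poly_(m < N) (m%:R ^+ k)
    + (1 - 'X) ^+ k.+1 * \poly_(m < N) (m%:R ^+ k.+1)
    + 'X^N * (N%:R *: Q + 'X * Q^`()) :> {poly K}.
  rewrite {1}IH derivD !derivM hS -hL !mulrDr.
  rewrite !(mulrA 'X _^`()) hXN -!mul_polyC; ring.
rewrite IH -!mul_polyC !exprS; ring.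
Qed.

Lemma is_euler_rec k : is_euler_poly k (euler_rec k).
Proof.
move=> j; have [Q ->] := euler_rec_series k j.+1.
rewrite coefD coefXnM ltnSn addr0 coefM; apply: eq_bigr => i _.
by rewrite coef_poly ltnS leq_subr.
Qed.

Lemma euler_poly_exists k : {A : {poly K} | is_euler_poly k A}.
Proof. by exists (euler_rec k); exact: is_euler_rec. Qed.

(* The Euler polynomial A_k; it is the only polynomial satisfying the defining
   identity, by is_euler_poly_uniq. *)
Definition euler_poly k : {poly K} := sval (euler_poly_exists k).

Lemma euler_polyP k : is_euler_poly k (euler_poly k).
Proof. exact: svalP. Qed.

Lemma euler_polyE k : euler_poly k = euler_rec k.
Proof. exact: is_euler_poly_uniq (euler_polyP k) (is_euler_rec k). Qed.

End EulerPolynomials.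

Section Operators.
Variables (K : numFieldType) (n : nat).

(* {poly_n.+1 K} bounds the size by n.+1, i.e. the degree by n.  The linear map
   x^p |-> F p; npolyp truncates to degree at most n, but all the polynomials it
   is applied to already satisfy this bound: see UopE, JopE and EopE. *)
Definition lin_of_monomials (F : nat -> {poly K}) (f : {poly_n.+1 K}) :
    {poly_n.+1 K} :=
  npolyp n.+1 (\sum_(p < n.+1) f`_p *: F p).

Fact lin_of_monomials_linear F : linear (lin_of_monomials F).
Proof.
move=> a f g; apply/npolyP => j; rewrite !(coef_npolyp, coefD, coefZ).
case: ifP => _; last by rewrite mulr0 addr0.
rewrite !coef_sum mulr_sumr -big_split /=; apply: eq_bigr => i _.
by rewrite !(coefZ, coefD) mulrDl mulrA.
Qed.
HB.instance Definition _ F :=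
  GRing.isLinear.Build K {poly_n.+1 K} {poly_n.+1 K} _ (lin_of_monomials F)
    (lin_of_monomials_linear F).

Lemma lin_of_monomialsE (F : nat -> {poly K}) (f : {poly_n.+1 K}) :
  (forall p, (p <= n)%N -> (size (F p) <= n.+1)%N) ->
  linfun (lin_of_monomials F) f = \sum_(p < n.+1) f`_p *: F p :> {poly K}.
Proof.
move=> hF; rewrite lfunE /= npolypK // (leq_trans (size_sum _ _ _)) //.
apply/bigmax_leqP => i _; rewrite (leq_trans (size_scale_leq _ _)) //.
by rewrite hF // -ltnS.
Qed.

Definition Uimage p : {poly K} :=
  (n`!%:R)^-1 *: ((1 - 'X) ^+ (n - p) * euler_poly K p).

Definition Uop : 'End({poly_n.+1 K}) := linfun (lin_of_monomials Uimage).

Definition Jop : 'End({poly_n.+1 K}) :=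
  linfun (lin_of_monomials (fun p => 'X^(n - p))).

Definition shift (c : K) (f : {poly_n.+1 K}) : {poly_n.+1 K} :=
  npolyp n.+1 (polyn f \Po ('X + c%:P)).

Fact shift_linear c : linear (shift c).
Proof.
move=> a f g; apply/npolyP => j; rewrite /shift.
rewrite !(coef_npolyp, coefD, coefZ) comp_polyD comp_polyZ coefD coefZ.
by case: ifP => _ //; rewrite mulr0 addr0.
Qed.
HB.instance Definition _ c :=
  GRing.isLinear.Build K {poly_n.+1 K} {poly_n.+1 K} _ (shift c)
    (shift_linear c).

Definition Eop (c : K) : 'End({poly_n.+1 K}) := linfun (shift c).

(* (f^-1)%VF is a generalized inverse in general; Uop is bijective by Uop_inj. *)
Definition Gop (beta : K) : 'End({poly_n.+1 K}) :=
  (Uop \o Eop (n%:R * beta) \o Uop^-1)%VF.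

Lemma size_1subX_exp m : (size ((1 - 'X : {poly K}) ^+ m) <= m.+1)%N.
Proof.
rewrite (leq_trans (size_poly_exp_leq _ _)) // ltnS.
have : (size (1 - 'X : {poly K})%R <= 2)%N.
  by rewrite (leq_trans (size_polyD _ _)) // size_polyN size_polyX size_poly1.
by case: size => [|[|[|]]] // _; rewrite ?mul0n ?mul1n.
Qed.

Lemma size_Uimage p : (p <= n)%N -> (size (Uimage p) <= n.+1)%N.
Proof.
move=> hp; rewrite (leq_trans (size_scale_leq _ _)) //.
rewrite (leq_trans (size_polyMleq _ _)) // euler_polyE.
have := leq_add (size_1subX_exp (n - p)) (size_euler_rec K p).
by rewrite addSn addnS subnK // -!subn1 => h; rewrite leq_subLR.
Qed.

Lemma UopE (f : {poly_n.+1 K}) :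
  Uop f = \sum_(p < n.+1) f`_p *: Uimage p :> {poly K}.
Proof. exact: lin_of_monomialsE size_Uimage. Qed.

Lemma JopE (f : {poly_n.+1 K}) :
  Jop f = \sum_(p < n.+1) f`_p *: 'X^(n - p) :> {poly K}.
Proof.
by apply: lin_of_monomialsE => p _; rewrite size_polyXn ltnS leq_subr.
Qed.

Lemma EopE c (f : {poly_n.+1 K}) :
  Eop c f = polyn f \Po ('X + c%:P) :> {poly K}.
Proof.
by rewrite lfunE /= npolypK // size_comp_poly2 ?size_npoly // size_XaddC.
Qed.

(* By lker0_compVf and lker0_compfV, (Uop^-1)%VF is then a two-sided inverse. *)
Lemma Uop_inj : lker Uop == 0%VS.
Proof.
apply/eqP/vspaceP => f; rewrite memv_ker memv0; apply/eqP/eqP => [U0|->]; last first.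
  by rewrite linear0.
have {}U0 : \sum_(p < n.+1) f`_p *: Uimage p = 0 by rewrite -UopE U0.
suff H m : (m <= n)%N -> f`_(n - m) = 0.
  apply/npolyP => j; rewrite coef0; have [hj|hj] := leqP j n.
    by rewrite -(subKn hj) H ?leq_subr.
  by rewrite nth_default // (leq_trans (size_npoly f)).
elim/ltn_ind: m => m IH hm.
have hd : (n`!%:R : K) != 0 by rewrite pnatr_eq0 -lt0n fact_gt0.
have : (1 - 'X) ^+ m *
   \sum_(p < n.+1 | (p <= n - m)%N)
      f`_p *: ((1 - 'X) ^+ (n - m - p) * euler_poly K p) = 0.
  apply: (scalerI (invr_neq0 hd)); rewrite scaler0 -[RHS]U0.
  rewrite mulr_sumr scaler_sumr [RHS](bigID (fun p : 'I_n.+1 => (p <= n - m)%N)) /=.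
  rewrite [X in _ = _ + X]big1 ?addr0 => [|p hp]; last first.
    rewrite -(subKn (ltn_ord p : (p <= n)%N)) IH ?scale0r ?leq_subr //.
    by move: hp; rewrite -ltnNge ltn_subCl // -ltnS.
  apply: eq_bigr => p hp; rewrite /Uimage -scalerAr !scalerA [in RHS]mulrC.
  have hmp : (m <= n - p)%N.
    by rewrite leq_subRL ?leq_ord // addnC -leq_subRL.
  by rewrite mulrA -exprD subnAC subnKC.
move/eqP; rewrite mulf_eq0 expf_eq0 => /orP[/andP[_]|/eqP].
  by rewrite -oppr_eq0 opprB polyXsubC_eq0.
move/(congr1 (horner^~ 1)); rewrite horner_sum horner0.
have hnm : (n - m < n.+1)%N by rewrite ltnS leq_subr.
rewrite (bigD1 (Ordinal hnm)) //= big1 => [|p /andP[hp hpn]]; last first.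
  rewrite hornerZ hornerM horner_exp hornerD hornerN hornerX hornerC subrr expr0n subn_eq0.
  have -> : (n - m <= p)%N = false.
    apply/negbTE; apply: contraNN hpn => hle.
    by rewrite -val_eqE /= eqn_leq hp.
  by rewrite mul0r mulr0.
rewrite subnn expr0 mul1r hornerZ euler_polyE euler_rec1 addr0 => /eqP.
by rewrite mulf_eq0 pnatr_eq0 eqn0Ngt fact_gt0 orbF => /eqP.
Qed.

End Operators.

Arguments Uop {K} n.
Arguments Jop {K} n.
Arguments Eop {K} n c.
Arguments Gop {K} n beta.

(* Main.v *)
From HB Require Import structures.
Require Import Defs.
From mathcomp Require Import all_boot all_order all_algebra.
From mathcomp Require Import qpoly ring.
From mathcomp Require Import reals complex.

(* U_n f is (1-x)^(n+1)/n! times the series \sum_m f(m) x^m.  It intertwines J_n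
   with the reflection W_n : f(x) |-> (-1)^n f(-1-x), i.e. J_n U_n = U_n W_n; as
   W_n E^c W_n = E^(-c), the theorem follows by conjugation.  The intertwining is
   proved by induction on n, writing f = x g + c with g of degree at most n: on
   the side of U, multiplying f by x amounts to applying the operator x d/dx to
   the series. *)

Import GRing.Theory.
Local Open Scope ring_scope.

Section EulerReflection.
Variable K : numFieldType.
Implicit Types (f g : {poly K}) (n : nat).

(** This is n! U_n, taken on unbounded polynomials so that n can vary in the induction. *)
Definition euler_num n f : {poly K} :=
  \sum_(p < n.+1) f`_p *: ((1 - 'X) ^+ (n - p) * euler_rec K p).

Definition revp n f : {poly K} := \poly_(j < n.+1) f`_(n - j).

Definition reflp n f : {poly K} := (-1) ^+ n *: (f \Po (- 1 - 'X)).

Lemma euler_num_linear n : linear (euler_num n).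
Proof.
move=> a f g; rewrite /euler_num scaler_sumr -big_split /=.
by apply: eq_bigr => p _; rewrite coefD coefZ scalerDl scalerA.
Qed.
HB.instance Definition _ n :=
  GRing.isLinear.Build K {poly K} {poly K} _ (euler_num n) (euler_num_linear n).

Lemma revp_linear n : linear (revp n).
Proof.
move=> a f g; apply/polyP => j; rewrite !(coefD, coefZ, coef_poly).
by case: ifP => //; rewrite mulr0 addr0.
Qed.
HB.instance Definition _ n :=
  GRing.isLinear.Build K {poly K} {poly K} _ (revp n) (revp_linear n).

Lemma reflp_linear n : linear (reflp n).
Proof.
by move=> a f g; rewrite /reflp comp_polyD comp_polyZ scalerDr !scalerA mulrC.
Qed.
HB.instance Definition _ n :=
  GRing.isLinear.Build K {poly K} {poly K} _ (reflp n) (reflp_linear n).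

Lemma size_reflp n f : (size (reflp n f) <= size f)%N.
Proof.
rewrite (leq_trans (size_scale_leq _ _)) // size_comp_poly2 //.
by rewrite -opprD size_polyN addrC (size_XaddC 1).
Qed.

Lemma size_euler_num n f : (size (euler_num n f) <= n.+1)%N.
Proof.
rewrite (leq_trans (size_sum _ _ _)) //; apply/bigmax_leqP => p _.
rewrite (leq_trans (size_scale_leq _ _)) // (leq_trans (size_polyMleq _ _)) //.
have := leq_add (size_1subX_exp K (n - p)) (size_euler_rec K p).
by rewrite addSn addnS subnK ?leq_ord // -!subn1 => h; rewrite leq_subLR.
Qed.

(** The series of f is unchanged; only its prefactor (1-x)^(n+1) gains a factor 1-x. *)
Lemma euler_numS n f : (size f <= n.+1)%N ->
  euler_num n.+1 f = (1 - 'X) * euler_num n f.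
Proof.
move=> sf; rewrite /euler_num big_ord_recr /= (nth_default _ sf) scale0r addr0.
rewrite mulr_sumr; apply: eq_bigr => p _.
by rewrite subSn ?leq_ord // exprS -scalerAr mulrA.
Qed.

(** With N = (1-x)^(n+1) S, the product rule expresses (1-x)^(n+2) x S' through N and N'. The proof
    checks this on monomials, via the recursion of [euler_rec]. *)
Lemma euler_numMX n f : euler_num n.+1 ('X * f) =
  (1 - 'X) * ('X * (euler_num n f)^`()) + n.+1%:R *: ('X * euler_num n f).
Proof.
rewrite /euler_num big_ord_recl coefXM scale0r add0r raddf_sum.
rewrite !mulr_sumr scaler_sumr -big_split; apply: eq_bigr => p _ /=.
rewrite coefXM /= subSS derivZ -!scalerAr !scalerA [n.+1%:R * _]mulrC.
rewrite -scalerA -scalerDr; congr (_ *: _).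
have hd : (1 - 'X) * ((1 - 'X) ^+ (n - p))^`()
    = - ((n - p)%:R *: (1 - 'X) ^+ (n - p)) :> {poly K}.
  rewrite deriv_exp derivB derivC derivX sub0r; case: (n - p)%N => [|m].
    by rewrite mulr0n mulr0 scale0r oppr0.
  by rewrite mulN1r mulNrn mulrN mulrnAr exprS scaler_nat.
(* The part n-p cancels the derivative of (1-x)^(n-p); the part p+1 is the factor in [euler_rec]. *)
have hn : n.+1%:R = (n - p)%:R + p.+1%:R :> K.
  by rewrite -natrD addnS subnK ?leq_ord.
rewrite derivM !mulrDr [(1 - 'X) * ('X * (_ * _))]mulrCA.
rewrite (mulrA (1 - 'X) _^`()) hd hn -!mul_polyC polyCD; ring.
Qed.

Lemma revpMX n f : revp n.+1 ('X * f) = revp n f.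
Proof.
apply/polyP => j; rewrite !coef_poly coefXM subn_eq0.
case: (ltngtP j n.+1) => [h|h|->]; first by rewrite ltnS ltnW // subSn.
  by rewrite ltnS leqNgt h.
by rewrite ltnSn.
Qed.

Lemma revpS n f : (size f <= n.+1)%N -> revp n.+1 f = 'X * revp n f.
Proof.
move=> sf; apply/polyP => -[|j]; rewrite coefXM !coef_poly /=.
  by rewrite subn0 nth_default.
by rewrite ltnS subSS.
Qed.

(** On x^p the operator x d/dx has eigenvalue p, and on the reversed x^(n-p) it has eigenvalue
    n-p. *)
Lemma revp_theta n f :
  revp n ('X * f^`()) = n%:R *: revp n f - 'X * (revp n f)^`().
Proof.
apply/polyP => j; rewrite coefB coefZ coefXM coef_deriv !coef_poly coefXM.
rewrite coef_deriv subn_eq0; case: j => [|j] /=.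
  rewrite subn0 subr0 leqn0 mulr_natl.
  by case: n => [|n]; rewrite ?mulr0n.
case: (ltngtP n j.+1) => [h|h|->].
- by rewrite ltnS leqNgt h mulr0 mul0rn subr0.
- rewrite ltnS (ltnW h) mulr_natl -mulrnBr ?(ltnW h) //.
  by rewrite prednK // subn_gt0.
- by rewrite ltnSn subnn mulr_natl subrr.
Qed.

Lemma size_deriv_theta n f :
  (size f <= n.+1)%N -> (size ('X * f^`())%R <= n.+1)%N.
Proof.
move=> sf; apply/leq_sizeP => -[|j] hj; rewrite coefXM //= coef_deriv.
by rewrite nth_default ?mul0rn // (leq_trans sf).
Qed.

Lemma revp_euler_num n f : (size f <= n.+1)%N ->
  revp n (euler_num n f) = euler_num n (reflp n f).
Proof.
elim: n f => [|n IH] f sf.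
  rewrite (size1_polyC sf) /reflp comp_polyC expr0 scale1r.
  rewrite /euler_num big_ord1 coefC eqxx /= subnn expr0 mulr1.
  apply/polyP => -[|j]; rewrite coef_poly //= coefZ coef1 ?mulr0 //.
(* g = (f - f(0))/x. *)
pose g : {poly K} := \poly_(i < n.+1) f`_i.+1.
have sg : (size g <= n.+1)%N by exact: size_poly.
have -> : f = 'X * g + (f`_0)%:P.
  apply/polyP => -[|j]; rewrite coefD coefXM coefC coef_poly /= ?add0r // addr0.
  by case: ltnP => // hj; rewrite nth_default // (leq_trans sf).
rewrite !linearD /=; congr (_ + _); last first.
  (* Constant part: reversal turns the extra factor 1-x into x-1, and this sign is the one by which
     W_(n+1) differs from W_n. *)
  have sc : (size (f`_0)%:P <= n.+1)%N by rewrite (leq_trans (size_polyC_leq1 _)).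
  rewrite !euler_numS ?(leq_trans (size_reflp _ _)) //.
  rewrite mulrBl mul1r linearB /= revpS ?size_euler_num // revpMX IH //.
  rewrite /reflp exprS -scalerA !linearZ /= scaleN1r -!scalerAr -!mul_polyC; ring.
(* The sign in (-1)^(n+1) turns the factor -1-x into x+1. *)
have -> : reflp n.+1 ('X * g) = 'X * reflp n g + reflp n g.
  rewrite /reflp comp_polyM comp_polyX exprS -scalerA scaleN1r -!scalerAr.
  by rewrite -!mul_polyC; ring.
have sh := size_euler_num n g.
have sth := size_deriv_theta _ _ sh.
rewrite linearD /= [euler_num _ (reflp _ _)]euler_numS ?(leq_trans (size_reflp _ _)) //.
(* With M = [revp n (euler_num n g)], both sides reduce to (1-x) x M' + (n x + 1) M. *)
rewrite !euler_numMX -!IH // mulrBl mul1r !linearD linearN linearZ /=.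
rewrite revpS // !revpMX revp_theta -!mul_polyC -natr1 polyCD; ring.
Qed.

End EulerReflection.

Section Conjugation.
Variables (K : numFieldType) (n : nat).

Definition reflop (f : {poly_n.+1 K}) : {poly_n.+1 K} :=
  npolyp n.+1 (reflp K n f).

Lemma reflopE (f : {poly_n.+1 K}) : reflop f = reflp K n f :> {poly K}.
Proof. by rewrite npolypK // (leq_trans (size_reflp _ _ _)) // size_npoly. Qed.

Lemma Uop_euler_num (f : {poly_n.+1 K}) :
  Uop n f = (n`!%:R)^-1 *: euler_num K n f :> {poly K}.
Proof.
rewrite UopE scaler_sumr; apply: eq_bigr => p _.
by rewrite /Uimage euler_polyE !scalerA mulrC.
Qed.

Lemma Jop_revp (f : {poly_n.+1 K}) : Jop n f = revp K n f :> {poly K}.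
Proof.
rewrite JopE /revp poly_def (reindex_inj rev_ord_inj) /=.
by apply: eq_bigr => p _; rewrite subSS subKn // leq_ord.
Qed.

Lemma Jop_Uop (f : {poly_n.+1 K}) : Jop n (Uop n f) = Uop n (reflop f).
Proof.
apply/val_inj; rewrite /= Jop_revp !Uop_euler_num reflopE linearZ /=.
by rewrite revp_euler_num // size_npoly.
Qed.

(** The two signs (-1)^n cancel, and -1 - ((-1-x) + c) = x - c. *)
Lemma reflop_Eop c (f : {poly_n.+1 K}) :
  reflop (Eop n c (reflop f)) = Eop n (- c) f.
Proof.
apply/val_inj; rewrite /= reflopE !EopE reflopE /reflp.
rewrite !comp_polyZ scalerA -exprMn mulrNN mulr1 expr1n scale1r.
rewrite -!comp_polyA; congr (_ \Po _).
have compN (p q : {poly K}) : (- p) \Po q = - (p \Po q) by exact: raddfN.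
rewrite -polyC1 !(comp_polyD, compN, comp_polyC, comp_polyX) polyCN.
ring.
Qed.

Lemma Gop_opp beta :
  Gop n (- beta) = (Jop n \o Gop n beta \o Jop n)%VF
    :> 'End({poly_n.+1 K}).
Proof.
apply/lfunP => f; have U0 := Uop_inj K n.
(* With f = U_n g, moving both J_n through U_n leaves U_n W_n E^(n beta) W_n g on the right. *)
rewrite -[f](lker0_lfunVK U0) /Gop; move: ((Uop n)^-1%VF f) => g.
rewrite !comp_lfunE [Jop n (Uop n g)]Jop_Uop !lker0_lfunK // Jop_Uop reflop_Eop.
by rewrite mulrN.
Qed.

End Conjugation.

Theorem theorem15 (R : realType) (n : nat) (beta : R[i]) :
  Gop n (- beta) = (Jop n \o Gop n beta \o Jop n)%VF.
Proof. exact: Gop_opp. Qed.
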